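(* Let $\rho^{PH},\rho_1,\dots,\rho_r:L^p\to\mathbb R$ be translation invariant, law invariant, increasing risk measures that vanish at $0$, let $X\in L^p_+$, let $S\subseteq\mathcal R=\{1,\dots,r\}$, and let $\Omega=\bigsqcup_{k=0}^m\Omega_k$ be a measurable partition of $\Omega$. Let $\mathcal S_{S,X}$ be the set of incentive compatible tuples of contracts that minimize the sum of the risk measures of the insurers in $S$ and the policyholder, and let $\mathcal P_{S,X}$ be the set of Pareto optimal tuples of contracts (all as defined in the context). Then $$\mathcal S_{S,X}=\mathcal P_{S,X}.$$
   Context: Let $(\Omega,\mathcal F,\mathbb P)$ be a probability space and $p\in(0,\infty)$. $L^p=L^p(\Omega,\mathcal F,\mathbb P)$ is the set of $p$-integrable random variables and $L^p_+\subseteq L^p$ is the subset of nonnegative ones. A risk measure $\rho:L^p\to\mathbb R$ is increasing if $\rho(Z)\le\rho(W)$ whenever $Z\le W$ $\mathbb P$-a.s.; translation invariant if $\rho(Z+a)=\rho(Z)+a$ for all $a\in\mathbb R$ and $Z\in L^p$; law invariant if $\rho(Z)=\rho(W)$ whenever $Z$ and $W$ have the same distribution. It vanishes at (fixes) $0$ if $\rho(0)=0$. There is one policyholder with risk measure $\rho^{PH}$ and initial risk $X\in L^p_+$, and there are insurers $\mathcal R=\{1,\dots,r\}$ with risk measures $\rho_1,\dots,\rho_r$. The set $S\subseteq\mathcal R$ consists of the insurers the policyholder trades with. The event $\Omega_0$ is a riskless environment and $\Omega_1,\dots,\Omega_m$ are risky environments. The set $\mathcal I_S$ of feasible indemnity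 tuples consists of all families $I=(I^i_k)_{i\in S,\,1\le k\le m}$ of functions $I^i_k:\mathbb R_+\to\mathbb R_+$ such that $0\le I^i_k\le \mathrm{id}$, every $I^i_k$ is increasing (nondecreasing), and for every $k$ the function $\mathrm{id}-\sum_{i\in S}I^i_k$ is increasing (nondecreasing). A feasible tuple of contracts is a family $(b_i,\pi_i,X_i)_{i\in S}$ with $b_i\in\mathbb R_+$ (bonus), $\pi_i\in\mathbb R_+$ (premium paid to insurer $i$), and $X_i\in L^p_+$ for which there is $I\in\mathcal I_S$ with $$X_i=b_i\mathbf 1_{\Omega_0}+\sum_{k=1}^m I^i_k(X)\mathbf 1_{\Omega_k}\qquad\text{for all } i\in S.$$ For such a tuple put $\pi:=\sum_{i\in S}\pi_i$ and $X^R:=X-\sum_{i\in S}X_i$. For a tuple with tildes, $\tilde\pi$ and $\tilde X^R$ are defined in the same way. The set $\mathcal C_{S,X}$ of incentive compatible tuples consists of the feasible tuples of contracts with $\rho_i(X_i-\pi_i)\le 0$ for all $i\in S$ and $\rho^{PH}(X^R+\pi)\le\rho^{PH}(X)$. The set $\mathcal P_{S,X}$ of Pareto optimal tuples consists of those $(b_i,\pi_i,X_i)_{i\in S}\in\mathcal C_{S,X}$ for which there is no feasible tuple of contracts $(\tilde b_i,\tilde\pi_i,\tilde X_i)_{i\in S}$ with $\rho_i(\tilde X_i-\tilde\pi_i)\le\rho_i(X_i-\pi_i)$ for all $i\in S$ and $\rho^{PH}(\tilde X^R+\tilde\pi)\le\rho^{PH}(X^R+\pi)$, with at least one of these inequalities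 strict. Finally, $$\mathcal S_{S,X}:=\operatorname*{arg\,min}_{(b_i,\pi_i,X_i)_{i\in S}\in\mathcal C_{S,X}}\left(\sum_{i\in S}\rho_i(X_i)+\rho^{PH}(X^R)\right).$$ *)

(* Defs.v *)
From HB Require Import structures.
From mathcomp Require Import all_boot all_order all_algebra.
From mathcomp Require Import all_classical all_reals all_analysis.
From mathcomp Require Import measurable_realfun.

Set Implicit Arguments.
Unset Strict Implicit.
Unset Printing Implicit Defensive.

Import Order.TTheory GRing.Theory Num.Theory.
Import numFieldNormedType.Exports.

Local Open Scope classical_set_scope.
Local Open Scope ring_scope.

(* [LfunType] requires an exponent [>= 1]; here the exponent is an arbitrary
   positive real, and only the additive structure is provided. Elements are
   genuine functions, not classes modulo almost sure equality. *)
Section Lp.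
Context d (T : measurableType d) (R : realType) (P : probability T R).
Variable p : {posnum R}.

Definition Lp_pred : {pred T -> R} := Lfun P p%:num%:E.

Lemma Lp_predP (f : T -> R) : f \in Lp_pred <->
  measurable_fun setT f /\ (\int[P]_x (`|f x| `^ p%:num)%:E < +oo)%E.
Proof.
have p0 : p%:num != 0 :> R by [].
have e : (\int[P]_x (`|f x| `^ p%:num)%:E =
          'N[P]_p%:num%:E[EFin \o f] `^ p%:num)%E.
  by rewrite powR_Lnorm//; apply: eq_integral => x _; rewrite poweR_EFin.
rewrite e; split.
- case/andP; rewrite inE => mf; rewrite inE /= /finite_norm => nf.
  by split=> //; exact: poweR_lty.
- move=> [mf nf]; apply/andP; split; rewrite inE//= /finite_norm.
  exact: lty_poweRy nf.
Qed.

Lemma Lp_pred_cst (a : R) : cst a \in Lp_pred.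
Proof. exact: Lfun_cst. Qed.

Lemma Lp_pred_zmod_closed : zmod_closed Lp_pred.
Proof.
split; first exact: Lp_pred_cst.
move=> f g /Lp_predP[mf If] /Lp_predP[mg Ig]; apply/Lp_predP.
have mfg : measurable_fun setT (f - g) by exact: measurable_funB.
split=> //.
have mpow (h : T -> R) : measurable_fun setT h ->
    measurable_fun setT (fun x => (`|h x| `^ p%:num)%:E).
  move=> mh; apply/measurable_EFinP.
  apply: (@measurableT_comp _ _ _ _ _ _ (@powR R ^~ p%:num)) => //.
  exact: measurableT_comp.
pose c : R := 2 `^ p%:num.
have c0 : 0 <= c by exact: powR_ge0.
apply: (@le_lt_trans _ _
  (\int[P]_x (c%:E * ((`|f x| `^ p%:num)%:E + (`|g x| `^ p%:num)%:E))))%E.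
  apply: ge0_le_integral => //.
  - exact: mpow.
  - by apply: measurable_funeM; apply: emeasurable_funD; apply: mpow.
  move=> x _; rewrite -EFinD -EFinM lee_fin.
  apply: (@le_trans _ _ ((2 * Num.max `|f x| `|g x|) `^ p%:num)).
    apply: ge0_ler_powR; rewrite ?nnegrE ?mulr_ge0 ?le_max ?normr_ge0//.
    apply: (le_trans (ler_normB _ _)); rewrite mulr_natl mulr2n.
    by apply: lerD; rewrite le_max lexx ?orbT.
  rewrite powRM// ?le_max ?normr_ge0//; apply: ler_wpM2l => //.
  by case: (leP `|f x| `|g x|) => _; rewrite ?lerDl ?lerDr powR_ge0.
rewrite ge0_integralZl//; last 2 first.
- by apply: emeasurable_funD; apply: mpow.
- by move=> x _; rewrite adde_ge0// lee_fin powR_ge0.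
rewrite ge0_integralD//; try exact: mpow.
apply: lte_mul_pinfty => //.
exact: lte_add_pinfty.
Qed.

HB.instance Definition _ :=
  GRing.isZmodClosed.Build _ Lp_pred Lp_pred_zmod_closed.

Record Lp := MkLp { Lp_val :> T -> R ; Lp_valP : Lp_val \in Lp_pred }.

HB.instance Definition _ := [isSub for Lp_val].
HB.instance Definition _ := [Choice of Lp by <:].
HB.instance Definition _ := [SubChoice_isSubZmodule of Lp by <:].

Lemma measurable_Lp (f : Lp) : measurable_fun setT f.
Proof. by have /Lp_predP[] := Lp_valP f. Qed.

HB.instance Definition _ (f : Lp) :=
  isMeasurableFun.Build _ _ _ _ (Lp_val f) (measurable_Lp f).

Definition Lp_cst (a : R) : Lp := MkLp (Lp_pred_cst a).

End Lp.

Section RiskMeasures.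
Context d (T : measurableType d) (R : realType) (P : probability T R).
Context (p : {posnum R}).
Implicit Type rho : Lp P p -> R.

Definition increasing rho :=
  forall Z W : Lp P p, {ae P, forall w, Z w <= W w} -> rho Z <= rho W.

Definition translation_invariant rho :=
  forall (Z : Lp P p) (a : R), rho (Z + Lp_cst P p a) = rho Z + a.

(* [distribution P Z] is a function on all sets of reals, whose values on
   non-Borel sets are meaningless, hence the restriction to measurable sets. *)
Definition same_distribution (Z W : Lp P p) :=
  forall A : set R, measurable A -> distribution P Z A = distribution P W A.

Definition law_invariant rho :=
  forall Z W : Lp P p, same_distribution Z W -> rho Z = rho W.

Definition vanishes_at_0 rho := rho 0 = 0.

End RiskMeasures.

Section Partition.
Context d (T : measurableType d).

(* [Omega ord0] is the riskless environment, and the risky ones are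
   [Omega (lift ord0 k)] for [k : 'I_m]. Cells may be empty. *)
Definition measurable_partition m (Omega : 'I_m.+1 -> set T) :=
  [/\ forall k, measurable (Omega k),
      trivIset [set: 'I_m.+1] Omega
    & \bigcup_k Omega k = [set: T]].

End Partition.

Section Contracts.
Context d (T : measurableType d) (R : realType) (P : probability T R).
Context (p : {posnum R}).
Context (r : nat) (S : {set 'I_r}) (m : nat) (Omega : 'I_m.+1 -> set T).
Context (rhoPH : Lp P p -> R) (rho : 'I_r -> Lp P p -> R) (X : Lp P p).

Local Notation insurer := {i : 'I_r | i \in S}.

Definition nondecreasing_nneg (f : R -> R) :=
  {in Num.nneg &, {homo f : x y / x <= y}}.

(* Functions on the nonnegative reals are represented by functions on [R]
   whose values at negative arguments are irrelevant. *)
Definition feasible_indemnities (I : insurer -> 'I_m -> R -> R) :=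
  [/\ forall i k x, 0 <= x -> 0 <= I i k x <= x,
      forall i k, nondecreasing_nneg (I i k)
    & forall k, nondecreasing_nneg (fun x => x - \sum_i I i k x)].

Record contracts := Contracts {
  bonus : insurer -> R ;
  premium : insurer -> R ;
  ceded : insurer -> Lp P p }.

Definition feasible (c : contracts) :=
  [/\ forall i, 0 <= bonus c i,
      forall i, 0 <= premium c i,
      forall i w, 0 <= ceded c i w
    & exists2 I, feasible_indemnities I &
        forall i w, ceded c i w =
          bonus c i * \1_(Omega ord0) w
          + \sum_(k < m) I i k (X w) * \1_(Omega (lift ord0 k)) w].

Definition total_premium (c : contracts) : R := \sum_i premium c i.

Definition retained (c : contracts) : Lp P p := X - \sum_i ceded c i.

Definition insurer_risk (c : contracts) (i : insurer) : R :=
  rho (val i) (ceded c i - Lp_cst P p (premium c i)).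

Definition policyholder_risk (c : contracts) : R :=
  rhoPH (retained c + Lp_cst P p (total_premium c)).

Definition incentive_compatible : set contracts :=
  [set c | [/\ feasible c,
               forall i, insurer_risk c i <= 0
             & policyholder_risk c <= rhoPH X]].

Definition pareto_dominates (c' c : contracts) :=
  [/\ forall i, insurer_risk c' i <= insurer_risk c i,
      policyholder_risk c' <= policyholder_risk c
    & (exists i, insurer_risk c' i < insurer_risk c i) \/
      policyholder_risk c' < policyholder_risk c].

Definition pareto_optimal : set contracts :=
  [set c | incentive_compatible c /\
           ~ exists2 c', feasible c' & pareto_dominates c' c].

Definition total_risk (c : contracts) : R :=
  \sum_i rho (val i) (ceded c i) + rhoPH (retained c).

Definition risk_minimizers : set contracts :=
  [set c | incentive_compatible c /\
           forall c', incentive_compatible c' -> total_risk c <= total_risk c'].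

End Contracts.

Arguments incentive_compatible {d T R P p r} S {m} Omega rhoPH rho X.
Arguments pareto_optimal {d T R P p r} S {m} Omega rhoPH rho X.
Arguments risk_minimizers {d T R P p r} S {m} Omega rhoPH rho X.

(* Main.v *)
(* Premiums are pure transfers: by translation invariance they cancel in the sum
   of all risks, so a Pareto improvement lowers the total risk. Conversely, the
   ceded risks of a tuple with smaller total risk can be repriced so that every
   insurer keeps its current risk, which leaves the whole gain to the
   policyholder. The new premiums are nonnegative because [rho i] is
   nonnegative on nonnegative risks and incentive compatible insurers have
   nonpositive risk. *)

Require Import Defs.
From mathcomp Require Import all_boot all_order all_algebra.
From mathcomp Require Import all_classical all_reals all_analysis.

Set Implicit Arguments.
Unset Strict Implicit.
Unset Printing Implicit Defensive.

Import Order.TTheory GRing.Theory Num.Theory.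
Import numFieldNormedType.Exports.

Local Open Scope classical_set_scope.
Local Open Scope ring_scope.

Section PremiumTransfers.
Context d (T : measurableType d) (R : realType) (P : probability T R).
Context (p : {posnum R}).

Lemma Lp_cstN (a : R) : Lp_cst P p (- a) = - Lp_cst P p a.
Proof. exact: val_inj. Qed.

Lemma translation_invariantB (rho : Lp P p -> R) (Z : Lp P p) (a : R) :
  translation_invariant rho -> rho (Z - Lp_cst P p a) = rho Z - a.
Proof. by move=> rho_ti; rewrite -Lp_cstN rho_ti. Qed.

Lemma increasing_ge0 (rho : Lp P p -> R) (Z : Lp P p) :
  increasing rho -> vanishes_at_0 rho -> (forall w, 0 <= Z w) -> 0 <= rho Z.
Proof.
move=> rho_incr rho_0 Z_ge0; rewrite -rho_0; apply: rho_incr.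
exact: aeW.
Qed.

Context (r : nat) (S : {set 'I_r}) (m : nat) (Omega : 'I_m.+1 -> set T).
Context (rhoPH : Lp P p -> R) (rho : 'I_r -> Lp P p -> R) (X : Lp P p).
Context (rhoPH_ti : translation_invariant rhoPH).
Context (rho_ti : forall i, translation_invariant (rho i)).
Implicit Type c : contracts P p S.

Lemma insurer_riskE c i :
  insurer_risk rho c i = rho (val i) (ceded c i) - premium c i.
Proof. exact: translation_invariantB. Qed.

Lemma policyholder_riskE c :
  policyholder_risk rhoPH X c = rhoPH (retained X c) + total_premium c.
Proof. exact: rhoPH_ti. Qed.

Lemma total_riskE c : total_risk rhoPH rho X c =
  \sum_i insurer_risk rho c i + policyholder_risk rhoPH X c.
Proof.
under eq_bigr do rewrite insurer_riskE.
rewrite policyholder_riskE /total_risk /total_premium sumrB.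
by rewrite [_ + \sum_i _]addrC addrA subrK.
Qed.

(** The total risk is the sum of the risks net of premiums, so adding up the weak inequalities and
    the strict one gives a strict inequality. *)
Lemma pareto_dominates_total_risk c' c :
  pareto_dominates rhoPH rho X c' c ->
  total_risk rhoPH rho X c' < total_risk rhoPH rho X c.
Proof.
move=> [le_ins le_ph lt_some]; rewrite !total_riskE.
case: lt_some => [[i lt_i]|lt_ph]; last by rewrite ler_ltD ?ler_sum.
(* The strictly better insurer [i] is split off from both sums. *)
rewrite ltr_leD // (bigD1 i) //= [ltRHS](bigD1 i) //=.
by rewrite ltr_leD // ler_sum.
Qed.

(** The bounds [0] and [rhoPH X] do not depend on the tuple, so lowering the risks preserves them.
    This makes a dominating tuple a competitor in the minimization. *)
Lemma pareto_dominates_incentive_compatible c' c :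
  feasible Omega X c' -> pareto_dominates rhoPH rho X c' c ->
  incentive_compatible S Omega rhoPH rho X c ->
  incentive_compatible S Omega rhoPH rho X c'.
Proof.
move=> feas' [le_ins le_ph _] [_ ins_le0 ph_le]; split=> // [i|].
  exact: le_trans (le_ins i) (ins_le0 i).
exact: le_trans le_ph ph_le.
Qed.

(** The premium solves [rho i (ceded c i) - premium = u i], so [u] prescribes the insurers'
    risks. *)
Definition reprice c (u : {i : 'I_r | i \in S} -> R) : contracts P p S :=
  Contracts (bonus c) (fun i => rho (val i) (ceded c i) - u i) (ceded c).

Lemma insurer_risk_reprice c u i : insurer_risk rho (reprice c u) i = u i.
Proof. by rewrite insurer_riskE /= subKr. Qed.

(** Only the sign of the new premiums is at stake: [u i <= 0 <= rho i (ceded c i)]. *)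
Lemma feasible_reprice c u :
  (forall i, increasing (rho i)) -> (forall i, vanishes_at_0 (rho i)) ->
  (forall i, u i <= 0) ->
  feasible Omega X c -> feasible Omega X (reprice c u).
Proof.
move=> rho_incr rho_0 u_le0 [b_ge0 _ X_ge0 exI]; split=> //= i.
by rewrite subr_ge0 (le_trans (u_le0 i)) ?increasing_ge0.
Qed.

Lemma pareto_dominates_reprice c' c :
  total_risk rhoPH rho X c' < total_risk rhoPH rho X c ->
  pareto_dominates rhoPH rho X (reprice c' (insurer_risk rho c)) c.
Proof.
move=> lt_tot; set c'' := reprice _ _.
have lt_ph : policyholder_risk rhoPH X c'' < policyholder_risk rhoPH X c.
  (* [total_risk] does not mention premiums, so its values at [c''] and [c'] are convertible. *)
  have : total_risk rhoPH rho X c'' < total_risk rhoPH rho X c by [].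
  rewrite !total_riskE; under eq_bigr do rewrite insurer_risk_reprice.
  by rewrite ltrD2l.
split; [by move=> i; rewrite insurer_risk_reprice | exact: ltW | by right].
Qed.

End PremiumTransfers.

Theorem theorem1 (d : measure_display) (T : measurableType d) (R : realType)
    (P : probability T R) (p : {posnum R}) (r : nat)
    (rhoPH : Lp P p -> R) (rho : 'I_r -> Lp P p -> R)
    (rhoPH_ti : translation_invariant rhoPH)
    (rhoPH_li : law_invariant rhoPH)
    (rhoPH_incr : increasing rhoPH)
    (rhoPH_0 : vanishes_at_0 rhoPH)
    (rho_ti : forall i, translation_invariant (rho i))
    (rho_li : forall i, law_invariant (rho i))
    (rho_incr : forall i, increasing (rho i))
    (rho_0 : forall i, vanishes_at_0 (rho i))
    (X : Lp P p) (X_ge0 : forall w, 0 <= X w)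
    (S : {set 'I_r}) (m : nat) (Omega : 'I_m.+1 -> set T)
    (Omega_partition : measurable_partition Omega) :
  risk_minimizers S Omega rhoPH rho X = pareto_optimal S Omega rhoPH rho X.
Proof.
apply/seteqP; split=> c [ic_c opt_c]; split=> //.
  move=> [c' feas' dom]; move: (pareto_dominates_total_risk rhoPH_ti rho_ti dom).
  apply/negP; rewrite -leNgt; apply: opt_c.
  exact: pareto_dominates_incentive_compatible dom ic_c.
move=> c' [feas' _ _]; rewrite leNgt; apply/negP => lt_tot; apply: opt_c.
(* Incentive compatibility of [c] makes these target risks nonpositive. *)
exists (reprice rho c' (insurer_risk rho c)).
  by apply: feasible_reprice => //; case: ic_c.
exact: pareto_dominates_reprice.
Qed.
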